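(* Let $k$ be a positive real number and let $\mu\ge 1$ be an integer. Then $$\frac{B(k,\mu)}{\mu^k}\ge \left(B_{k/\mu}\right)^{\mu}.$$
   Context: For real $k>0$ and $\mu>0$, $B(k,\mu)=\mathrm{E}[X^k]$, where $X$ is a Poisson random variable with mean $\mu$; that is, $B(k,\mu)=e^{-\mu}\sum_{i=0}^\infty \frac{i^k\mu^i}{i!}$. When $k$ is a positive integer this is the Bell (Touchard) polynomial $B(k,\mu)=\sum_{i=0}^k {k\brace i}\mu^i$, where ${k\brace i}$ are the Stirling numbers of the second kind. For real $x>0$, the generalised Bell number is $B_x=B(x,1)=\frac1e\sum_{i=0}^\infty\frac{i^x}{i!}$ (Dobiński's formula). *)

(* Defs.v *)
From HB Require Import structures.
From mathcomp Require Import all_boot all_order all_algebra.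
From mathcomp Require Import all_classical all_reals all_analysis.
From mathcomp Require Import ring.
Set Implicit Arguments.
Unset Strict Implicit.
Unset Printing Implicit Defensive.
Import Order.TTheory GRing.Theory Num.Theory.
Import numFieldNormedType.Exports.
Local Open Scope classical_set_scope.
Local Open Scope ring_scope.

(* B(k, mu) = E[X^k] for X Poisson with mean mu, realised as the identity on
   nat under poisson_prob mu; expectation_poisson_law shows that any Poisson
   variable gives the same value.  The nat argument 0 of poisson_prob is a
   dummy: its body does not use it.  The expectation is finite for k >= 0 and
   mu > 0 (expectation_poissonE), so fine is harmless there. *)
Definition poisson_moment {R : realType} (k mu : R) : R :=
  fine 'E_(poisson_prob mu 0)[fun i : nat => i%:R `^ k : R].

(* B_x = B(x, 1); see gen_bellE for Dobinski's formula *)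
Definition gen_bell {R : realType} (x : R) : R := poisson_moment x 1.

Lemma ge0_integral_poisson {R : realType} (mu : R) (f : nat -> \bar R) :
  0 < mu -> (forall i, 0 <= f i)%E ->
  (\int[poisson_prob mu 0]_i f i =
   \sum_(0 <= i <oo) (poisson_pmf mu i)%:E * f i)%E.
Proof.
move=> mu0 f0.
pose m_ (i : nat) : {measure set nat -> \bar R} :=
  mscale (NngNum (poisson_pmf_ge0 mu i)) (\d_i).
rewrite (@eq_measure_integral _ _ R setT (mseries m_ 0)); last first.
  move=> A mA _; rewrite [LHS]/= /poisson_prob mu0 [RHS]/= /mseries esum_mkcond.
  rewrite nneseries_esumT//; apply: eq_esum => i _.
  have -> : m_ i A = ((poisson_pmf mu i)%:E * \d_i A)%E by [].
  rewrite diracE; case: ifPn => _; first by rewrite mule1.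
  by rewrite mule0.
rewrite ge0_integral_measure_series//; apply: eq_eseriesr => i _.
by rewrite ge0_integral_mscale//= integral_dirac//= diracT mul1e.
Qed.

Lemma expectation_poisson_series {R : realType} (k mu : R) : 0 < mu ->
  ('E_(poisson_prob mu 0)[fun i : nat => (i%:R `^ k)%R : R] =
   \sum_(0 <= i <oo) (poisson_pmf mu i * i%:R `^ k)%:E)%E.
Proof.
move=> mu0; rewrite unlock ge0_integral_poisson//.
Qed.

Lemma powR_nat_le {R : realType} (k : R) : 0 <= k ->
  exists2 C : R, 0 <= C & forall i : nat, i%:R `^ k <= C * expR i%:R.
Proof.
move=> k0; have [n kn] : exists n : nat, k <= n.+1%:R.
  by exists (Num.truncn k); exact/ltW/truncnS_gt.
exists (n.+1`!%:R + 1); first by rewrite addr_ge0.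
case=> [|i].
  rewrite expR0 mulr1; have [->|kN0] := eqVneq k 0.
    by rewrite powRr0 lerDr.
  by rewrite powR0// addr_ge0.
have i1 : (1 : R) <= i.+1%:R by rewrite ler1n.
apply: (le_trans (ler_powR i1 kn)); rewrite powR_mulrn//.
have /ltW := lt_le_trans (ltr_pwDl ltr01 (lexx _))
  (expR_ge1Dxn n (ler0n R i.+1)).
rewrite ler_pdivrMr ?ltr0n ?fact_gt0// => /le_trans; apply.
by rewrite mulrC ler_wpM2r ?expR_ge0// lerDl.
Qed.

Lemma expectation_poisson_lty {R : realType} (k mu : R) : 0 <= k -> 0 < mu ->
  ('E_(poisson_prob mu 0)[fun i : nat => (i%:R `^ k)%R : R] < +oo)%E.
Proof.
move=> k0 mu0; rewrite expectation_poisson_series//.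
have [C C0 HC] := powR_nat_le k0.
pose r := mu * expR 1; have r0 : 0 < r by rewrite mulr_gt0// expR_gt0.
pose D := C * expR (- mu) * expR r.
have D0 : 0 <= D by rewrite !mulr_ge0// expR_ge0.
apply: (@le_lt_trans _ _ (\sum_(0 <= i <oo) (D * poisson_pmf r i)%:E)%E).
  apply: lee_nneseries => i _; first by
    rewrite lee_fin mulr_ge0// ?powR_ge0 ?poisson_pmf_ge0.
  rewrite lee_fin; apply: (le_trans (ler_wpM2l (poisson_pmf_ge0 _ _) (HC i))).
  rewrite /poisson_pmf mu0 r0 /D /r exprMn -expRM_natr mul1r.
  have E : expR (mu * expR 1) * expR (- (mu * expR 1)) = 1 :> R.
    by rewrite -expRD subrr expR0.
  rewrite le_eqVlt; apply/orP; left; apply/eqP.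
  by ring: E.
under eq_eseriesr do rewrite EFinM.
rewrite nneseriesZl//; last by move=> i _; rewrite lee_fin poisson_pmf_ge0.
have := @probability_setT _ _ _ (poisson_prob r 0).
rewrite [X in X = _ -> _]/= /poisson_prob r0 -nneseries_esumT; last first.
  by move=> i; rewrite lee_fin poisson_pmf_ge0.
by move=> ->; rewrite mule1 ltry.
Qed.

Lemma expectation_poissonE {R : realType} (k mu : R) : 0 <= k -> 0 < mu ->
  ('E_(poisson_prob mu 0)[fun i : nat => (i%:R `^ k)%R : R])%E =
  (poisson_moment k mu)%:E.
Proof.
move=> k0 mu0; rewrite /poisson_moment fineK// ge0_fin_numE.
  exact: expectation_poisson_lty.
by apply: expectation_ge0 => i; exact: powR_ge0.
Qed.

Lemma expectation_poisson_law {R : realType} (d : measure_display)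
    (T : measurableType d) (P : probability T R) (X : {RV P >-> nat})
    (k mu : R) :
  (forall A : set nat, distribution P X A = poisson_prob mu 0 A) ->
  ('E_P[fun w => ((X w)%:R `^ k)%R : R] =
   'E_(poisson_prob mu 0)[fun i : nat => (i%:R `^ k)%R : R])%E.
Proof.
move=> H; rewrite unlock.
rewrite -(@eq_measure_integral _ _ R setT _ (distribution P X)); last first.
  by move=> A _ _; exact: H.
by rewrite ge0_integral_distribution// => i; rewrite lee_fin powR_ge0.
Qed.

Lemma poisson_momentE {R : realType} (k mu : R) : 0 <= k -> 0 < mu ->
  poisson_moment k mu =
  expR (- mu) * limn (series (fun i : nat => i%:R `^ k * mu ^+ i / i`!%:R)).
Proof.
move=> k0 mu0.
pose u i : R := i%:R `^ k * mu ^+ i / i`!%:R.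
have u0 i : 0 <= u i.
  by rewrite !mulr_ge0 ?powR_ge0 ?exprn_ge0 ?invr_ge0// ltW.
pose S := (\sum_(0 <= i <oo) (u i)%:E)%E.
have H : ('E_(poisson_prob mu 0)[fun i : nat => (i%:R `^ k)%R : R] =
  (expR (- mu))%:E * S)%E.
  rewrite expectation_poisson_series// -nneseriesZl//; last first.
    by move=> i _; rewrite lee_fin.
  apply: eq_eseriesr => i _; rewrite /poisson_pmf mu0 -EFinM; congr EFin.
  by rewrite mulrC [RHS]mulrC !mulrA.
have S0 : (0 <= S)%E by apply: nneseries_ge0 => i _ _; rewrite lee_fin.
have Sfin : (S < +oo)%E.
  have := expectation_poisson_lty k0 mu0; rewrite H.
  move: S0; case: S {H} => [s _ _|_|]//; first exact: ltry.
  by rewrite gt0_muley// lte_fin expR_gt0.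
apply: EFin_inj; rewrite -expectation_poissonE// H EFinM; congr (_ * _)%E.
rewrite -EFin_lim.
  by apply/congr_lim/funext => n /=; rewrite /series/= sumEFin.
apply: nondecreasing_is_cvgn.
  apply/nondecreasing_seqP => n.
  by rewrite /series/= big_nat_recr//= lerDl; exact: u0.
exists (fine S) => _ [n _ <-]; rewrite -lee_fin fineK ?ge0_fin_numE//.
rewrite /series/= -sumEFin.
by apply: nneseries_lim_ge => i _ _; rewrite lee_fin; exact: u0.
Qed.

Lemma gen_bellE {R : realType} (x : R) : 0 <= x ->
  gen_bell x = (expR 1)^-1 * limn (series (fun i : nat => i%:R `^ x / i`!%:R)).
Proof.
move=> x0; rewrite /gen_bell poisson_momentE// expRN.
congr (_ * _); congr (limn (series _)); apply/funext => i.
by rewrite expr1n mulr1.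
Qed.

(* Main.v *)
Require Import Defs.
From mathcomp Require Import all_boot all_order all_algebra.
From mathcomp Require Import all_classical all_reals all_analysis.
From mathcomp Require Import ring zify.
Import Order.TTheory GRing.Theory Num.Theory.
Import numFieldNormedType.Exports.
Local Open Scope ring_scope.

(** If [X] and [Y] are independent Poisson variables with means [a] and [b], then
    [X + Y] is Poisson with mean [a + b], and the weighted arithmetic-geometric
    mean inequality gives
      [(X + Y) / (a + b) >= (X / a) ^ (a / (a + b)) * (Y / b) ^ (b / (a + b))].
    Raising this to the power [x (a + b)] and taking expectations, the right
    side factors by independence, so the function
      [a |-> E[(X / a) ^ (x a)]], with [X] Poisson of mean [a],
    is supermultiplicative ([poisson_moment_supermul]). At [a = 1] it equals
    the generalised Bell number of index [x], hence at [a = mu] it is at least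
    the [mu]-th power of that number ([gen_bell_expn_le]); [x = k / mu] is the
    desired inequality.

    Independence is never formalised: the product of the two expectations is a
    product of series with nonnegative terms, and its partial sums over squares
    are compared with partial sums over triangles [i + j = s]
    ([ler_sum_square_triangle]). Summing along the diagonal [i + j = s] turns
    the product of two Poisson weights into a Poisson weight
    ([poisson_pmfD]). *)

(** The normalised moment [E[(X / mu) ^ k]] as an ordinary limit of real partial
    sums, so that the product of two moments can be bounded through finite
    sums. *)
Lemma cvg_normalized_poisson_moment {R : realType} (k mu : R) :
  0 <= k -> 0 < mu ->
  (series (fun i => poisson_pmf mu i * (i%:R / mu) `^ k) @ \oo -->
   poisson_moment k mu / mu `^ k)%classic.
Proof.
move=> k0 mu0.
have muV0 : 0 <= mu^-1 by rewrite invr_ge0 ltW.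
have -> : series (fun i => poisson_pmf mu i * (i%:R / mu) `^ k) =
    (fun n => series (fun i => poisson_pmf mu i * i%:R `^ k) n / mu `^ k).
  apply/funext => n; rewrite /series/= mulr_suml; apply: eq_bigr => i _.
  by rewrite powRM// -powR_inv1 ?(ltW mu0)// -powRrM mulN1r powRN mulrA.
apply: cvgMl.
have : (\sum_(0 <= i < n) (poisson_pmf mu i * i%:R `^ k)%:E @[n --> \oo] -->
    (poisson_moment k mu)%:E)%E%classic.
  rewrite -expectation_poissonE// expectation_poisson_series//.
  apply: is_cvg_nneseries => i _ _.
  by rewrite lee_fin mulr_ge0// ?poisson_pmf_ge0 ?powR_ge0.
move/fine_cvg; apply: cvg_trans; apply: near_eq_cvg; apply: nearW => n /=.
by rewrite sumEFin.
Qed.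

(** The law of a sum of independent Poisson variables: after clearing the
    factorials this is the binomial theorem. *)
Lemma poisson_pmfD {R : realType} (a b : R) (n : nat) : 0 < a -> 0 < b ->
  \sum_(i < n.+1) poisson_pmf a i * poisson_pmf b (n - i) =
  poisson_pmf (a + b) n.
Proof.
move=> a0 b0; rewrite /poisson_pmf a0 b0 addr_gt0// opprD expRD.
rewrite addrC exprDn !mulr_suml; apply: eq_bigr => i _.
have ile : (i <= n)%N by rewrite -ltnS.
have /(congr1 (fun n => n%:R : R)) := bin_fact ile.
rewrite !natrM => <-.
have bN0 : 'C(n, i)%:R != 0 :> R by rewrite pnatr_eq0 -lt0n bin_gt0.
have fN0 j : j`!%:R != 0 :> R by rewrite pnatr_eq0 -lt0n fact_gt0.
rewrite -mulr_natr; field.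
by rewrite bN0 !fN0.
Qed.

(** The triangle [i + j < 2N] contains the square [i, j < N]. *)
Lemma ler_sum_square_triangle {R : numDomainType} (F : nat -> nat -> R) (N : nat) :
  (forall i j, 0 <= F i j) ->
  \sum_(i < N) \sum_(j < N) F i j <=
  \sum_(s < N + N) \sum_(i < s.+1) F i (s - i)%N.
Proof.
move=> F0.
(* Write the triangular sum over a rectangle with a filter, so that the order
   of summation can be exchanged and the row of each [i] compared. *)
rewrite [leRHS](eq_bigr (fun s : 'I_(N + N) =>
    \sum_(i < N + N | (i < s.+1)%N) F i (s - i)%N)); last first.
  by move=> s _; rewrite (big_ord_widen (N + N) (fun i => F i (s - i)%N)).
rewrite [leRHS](exchange_big_dep predT)//=.
rewrite [leLHS](@big_ord_widen _ _ _ N (N + N)%N (fun i => \sum_(j < N) F i j)) ?leq_addr//.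
rewrite big_mkcond ler_sum//= => i _; case: ifPn => [iN|_]; last first.
  by rewrite sumr_ge0.
rewrite -(big_geq_mkord i (N + N)%N xpredT (fun s => F i (s - i)%N)).
rewrite -[X in index_iota X]add0n big_addn.
under [leRHS]eq_bigr do rewrite addnK.
rewrite -(big_mkord xpredT (F i)).
have NNi : (N <= N + N - i)%N by lia.
by rewrite [leRHS](big_cat_nat (n := N))//= lerDl sumr_ge0.
Qed.

(** This is Young's inequality for the conjugate exponents [(a + b) / a] and
    [(a + b) / b]. *)
Lemma weighted_AGM {R : realType} (a b u v : R) :
  0 < a -> 0 < b -> 0 <= u -> 0 <= v ->
  u `^ (a / (a + b)) * v `^ (b / (a + b)) <= (a * u + b * v) / (a + b).
Proof.
move=> a0 b0 u0 v0.
have ab0 : 0 < a + b by rewrite addr_gt0.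
have [aN0 bN0 abN0] : [/\ a != 0, b != 0 & a + b != 0] by rewrite !gt_eqF.
have := @conjugate_powR R (u `^ (a / (a + b))) (v `^ (b / (a + b)))
  ((a + b) / a) ((a + b) / b) (powR_ge0 _ _) (powR_ge0 _ _).
rewrite !divr_gt0// -!powRrM => /(_ isT isT).
have -> : a / (a + b) * ((a + b) / a) = 1 by field; rewrite aN0 abN0.
have -> : b / (a + b) * ((a + b) / b) = 1 by field; rewrite bN0 abN0.
rewrite !powRr1// !invf_div -mulrDl divff// => /(_ erefl) /le_trans; apply.
by rewrite le_eqVlt; apply/orP; left; apply/eqP; field.
Qed.

(** The arithmetic-geometric mean inequality applied to [p / a] and [q / b]: the
    weights [a] and [b] are those for which the weighted mean of these ratios
    is the ratio [(p + q) / (a + b)] of the sums. *)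
Lemma powR_ratio_le {R : realType} (x a b p q : R) :
  0 <= x -> 0 < a -> 0 < b -> 0 <= p -> 0 <= q ->
  (p / a) `^ (x * a) * (q / b) `^ (x * b) <=
  ((p + q) / (a + b)) `^ (x * (a + b)).
Proof.
move=> x0 a0 b0 p0 q0.
have ab0 : 0 < a + b by rewrite addr_gt0.
have [aN0 bN0 abN0] : [/\ a != 0, b != 0 & a + b != 0] by rewrite !gt_eqF.
have -> : x * a = a / (a + b) * (x * (a + b)) by field.
have -> : x * b = b / (a + b) * (x * (a + b)) by field.
rewrite powRrM (powRrM (q / b)) -powRM ?powR_ge0//.
have -> : p + q = a * (p / a) + b * (q / b) by field; rewrite aN0 bN0.
rewrite ge0_ler_powR ?nnegrE ?mulr_ge0 ?powR_ge0 ?invr_ge0 ?(ltW ab0)//.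
  by rewrite addr_ge0 ?mulr_ge0 ?invr_ge0 ?(ltW a0) ?(ltW b0).
by apply: weighted_AGM; rewrite ?divr_ge0 ?(ltW a0) ?(ltW b0).
Qed.

(** Termwise, the product of the two summands at [i] and [j] is bounded by a
    quantity depending on [i] and [j] only through [i + j], apart from the
    Poisson weights, whose sum over [i + j = s] is known. *)
Lemma poisson_moment_supermul {R : realType} (x a b : R) :
  0 <= x -> 0 < a -> 0 < b ->
  poisson_moment (x * a) a / a `^ (x * a) *
  (poisson_moment (x * b) b / b `^ (x * b)) <=
  poisson_moment (x * (a + b)) (a + b) / (a + b) `^ (x * (a + b)).
Proof.
move=> x0 a0 b0; have ab0 : 0 < a + b by rewrite addr_gt0.
have [xa0 xb0 xab0] : [/\ 0 <= x * a, 0 <= x * b & 0 <= x * (a + b)].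
  by split; rewrite mulr_ge0// ltW.
have cab := cvg_normalized_poisson_moment _ _ xab0 ab0.
apply: (cvgr_to_le (cvgM (cvg_normalized_poisson_moment _ _ xa0 a0)
  (cvg_normalized_poisson_moment _ _ xb0 b0))).
apply: nearW => n.
have t0 i : 0 <= poisson_pmf (a + b) i * (i%:R / (a + b)) `^ (x * (a + b)).
  by rewrite mulr_ge0 ?poisson_pmf_ge0 ?powR_ge0.
apply: (@le_trans _ _ (series (fun i => poisson_pmf (a + b) i *
    (i%:R / (a + b)) `^ (x * (a + b))) (n + n)%N)); last first.
  rewrite -(cvg_lim _ cab)//; apply: nondecreasing_cvgn_le.
    by apply/nondecreasing_seqP => i; rewrite /series/= big_nat_recr//= lerDl.
  by apply/cvg_ex; eexists; exact: cab.
rewrite /series/= /GRing.mul_fun/= !big_mkord mulr_suml.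
under eq_bigr do rewrite mulr_sumr.
apply: le_trans (ler_sum_square_triangle (fun i j : nat =>
  poisson_pmf a i * (i%:R / a) `^ (x * a) *
  (poisson_pmf b j * (j%:R / b) `^ (x * b))) n _) _.
  by move=> i j; rewrite !mulr_ge0 ?poisson_pmf_ge0 ?powR_ge0.
apply: ler_sum => s _; rewrite -poisson_pmfD// mulr_suml.
apply: ler_sum => i _; rewrite mulrACA.
rewrite ler_wpM2l ?mulr_ge0 ?poisson_pmf_ge0//.
have -> : (s : nat)%:R = i%:R + (s - i)%N%:R :> R.
  by rewrite -natrD subnKC// -ltnS.
exact: powR_ratio_le.
Qed.

(** One factor is gained at each step, by supermultiplicativity with second mean
    [1], where the normalising denominator is [1]. *)
Lemma gen_bell_expn_le {R : realType} (x : R) (m : nat) : 0 <= x ->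
  gen_bell x ^+ m.+1 <=
  poisson_moment (x * m.+1%:R) m.+1%:R / m.+1%:R `^ (x * m.+1%:R).
Proof.
move=> x0; have bellE : gen_bell x = poisson_moment (x * 1) 1 / 1 `^ (x * 1).
  by rewrite powR1 divr1 mulr1.
elim: m => [|m IH]; first by rewrite expr1 bellE.
rewrite exprSr -(natr1 m.+1).
apply: le_trans (poisson_moment_supermul _ _ _ x0 _ _)=> //.
rewrite -bellE ler_wpM2r// /gen_bell /poisson_moment fine_ge0//.
by apply: expectation_ge0 => i; exact: powR_ge0.
Qed.

Theorem theorem2 (R : realType) (k : R) (mu : nat)
    (k_gt0 : 0 < k) (mu_ge1 : (1 <= mu)%N) :
  poisson_moment k mu%:R / mu%:R `^ k >= gen_bell (k / mu%:R) ^+ mu.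
Proof.
case: mu mu_ge1 => [//|m] _.
have := @gen_bell_expn_le R (k / m.+1%:R) m (divr_ge0 (ltW k_gt0) (ler0n _ _)).
by rewrite divfK ?pnatr_eq0.
Qed.
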